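(* Let $P=\{p_1,p_2,\dots,p_k\}$ be a nonempty set of permutations of $\{1,\dots,n\}$. The following are equivalent: (i) $P$ is a groupe de permutations; (ii) $P$ is a right coset of a group, i.e. $P=Ha$ for some subgroup $H\le S_n$ and some $a\in S_n$; (iii) $P$ is a left coset of a group, i.e. $P=aH$ for some subgroup $H\le S_n$ and some $a\in S_n$. Moreover, if $P$ is a right coset of a group $H$, then $H$ is the corresponding groupe de substitutions; and if $P$ is a left coset $aH$ of a group $H$, then $aHa^{-1}$ is the corresponding groupe de substitutions.
   Context: Permutations are composed from right to left. For permutations $p,q\in S_n$, the substitution $\begin{pmatrix}p\\ q\end{pmatrix}$ is the map sending $p(s)$ to $q(s)$ for each $s$, i.e. the permutation $qp^{-1}$. A nonempty set $P=\{p_1,\dots,p_k\}$ of permutations is a groupe de permutations if for every $1\le i\le k$ the set of substitutions $\left\{\begin{pmatrix}p_1\\ p_j\end{pmatrix}:1\le j\le k\right\}$ equals the set of substitutions $\left\{\begin{pmatrix}p_i\\ p_j\end{pmatrix}:1\le j\le k\right\}$. When this holds, this common set of substitutions is called the groupe de substitutions corresponding to (associated with) $P$. *)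

(* Defs.v *)
From mathcomp Require Import all_boot all_fingroup.

Set Implicit Arguments.
Unset Strict Implicit.
Unset Printing Implicit Defensive.

Local Open Scope group_scope.

(* Right-to-left composition of permutations: the MathComp product [s * t]
   applies [s] first. The subgroups of 'S_n are the same for both products,
   but left and right cosets are interchanged. *)
Definition rcomp n (s t : 'S_n) : 'S_n := t * s.

Notation "s ∘ t" := (rcomp s t) (at level 40, left associativity).

Lemma rcompE n (s t : 'S_n) x : (s ∘ t) x = s (t x).
Proof. exact: permM. Qed.

Definition substitution n (p q : 'S_n) : 'S_n := q ∘ p^-1.

Lemma substitutionE n (p q : 'S_n) s : substitution p q (p s) = q s.
Proof. by rewrite /substitution rcompE permK. Qed.

Definition substitutions_from n (P : {set 'S_n}) (p : 'S_n) : {set 'S_n} :=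
  [set substitution p q | q in P].

(* The base permutation p_1 is an arbitrary element of P, so the definition
   compares the sets of substitutions for any two elements of P. *)
Definition groupe_de_permutations n (P : {set 'S_n}) : Prop :=
  P != set0 /\
  {in P &, forall p q, substitutions_from P p = substitutions_from P q}.

(* G is the common value of the sets [substitutions_from P p], p in P. *)
Definition corresponding_groupe_de_substitutions n (P G : {set 'S_n}) : Prop :=
  groupe_de_permutations P /\ {in P, forall p, substitutions_from P p = G}.

Definition right_coset n (H : {group 'S_n}) (a : 'S_n) : {set 'S_n} :=
  [set h ∘ a | h in H].

Definition left_coset n (a : 'S_n) (H : {group 'S_n}) : {set 'S_n} :=
  [set a ∘ h | h in H].

Definition conjugate_set n (a : 'S_n) (H : {group 'S_n}) : {set 'S_n} :=
  [set a ∘ h ∘ a^-1 | h in H].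

(* Main.v *)
Require Import Defs.
From mathcomp Require Import all_boot all_fingroup.

(** In MathComp's left-to-right product the set of substitutions based at [p]
    is the translate [p^-1 *: P]. If these translates agree for all [p] in [P],
    their common value [H] is closed under products: [x = p0^-1 * p] and
    [y = p0^-1 * q], rewritten as [y = p^-1 * r], give [x * y = p0^-1 * r].
    Left cosets reduce to right cosets since [H a = a (a^-1 H a)]. *)

Local Open Scope group_scope.

Lemma substitutions_fromE n (P : {set 'S_n}) (p : 'S_n) :
  substitutions_from P p = p^-1 *: P.
Proof. by rewrite -lcosetE. Qed.

(* MathComp composes permutations in the opposite order, so the paper's right
   cosets are MathComp's left cosets, and conversely. *)
Lemma right_cosetE n (H : {group 'S_n}) (a : 'S_n) : right_coset H a = a *: H.
Proof. by rewrite -lcosetE. Qed.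

Lemma left_cosetE n (H : {group 'S_n}) (a : 'S_n) : left_coset a H = H :* a.
Proof. by rewrite -rcosetE. Qed.

(** With the product reversed, a h a^-1 unfolds to [a^-1 * (h * a)], which is [h ^ a] by
    definition. *)
Lemma conjugate_setE n (H : {group 'S_n}) (a : 'S_n) :
  conjugate_set a H = H :^ a.
Proof. by []. Qed.

Lemma left_coset_right_coset n (H : {group 'S_n}) (a : 'S_n) :
  left_coset a H = right_coset (H :^ a)%G a.
Proof. by rewrite left_cosetE right_cosetE /= conjsgE lcosetKV. Qed.

Lemma right_coset_left_coset n (H : {group 'S_n}) (a : 'S_n) :
  right_coset H a = left_coset a (H :^ a^-1)%G.
Proof.
rewrite left_coset_right_coset; congr right_coset.
by apply: val_inj; rewrite /= conjsgKV.
Qed.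

(** Any [p] in [a *: H] represents the same coset, so [p^-1 *: (a *: H) = p^-1 *: (p *: H) = H]
    whatever the base [p]. *)
Lemma right_coset_corresponding n (H : {group 'S_n}) (a : 'S_n) :
  corresponding_groupe_de_substitutions (right_coset H a) H.
Proof.
have subsH : {in right_coset H a,
    forall p, substitutions_from (right_coset H a) p = H}.
  move=> p; rewrite substitutions_fromE right_cosetE => pP.
  by rewrite -(lcoset_eqP pP) lcosetK.
split=> //; split=> [|p q pP qP]; last by rewrite !subsH.
by apply/set0Pn; exists a; rewrite right_cosetE lcoset_refl.
Qed.

Lemma substitutions_from_group_set n (P : {set 'S_n}) (p : 'S_n) :
  groupe_de_permutations P -> p \in P -> group_set (substitutions_from P p).
Proof.
move=> [_ eqP] pP; apply/group_setP; split.
  by rewrite substitutions_fromE mem_lcoset invgK mulg1.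
move=> x y; rewrite {1}substitutions_fromE mem_lcoset invgK => pxP.
(* Since [p * x] is in [P], the membership of [y] can be rebased from [p] to [p * x]; it then says
   that [p * x * y] is in [P]. *)
rewrite {1}(eqP _ _ pP pxP) !substitutions_fromE !mem_lcoset !invgK.
by rewrite mulgA.
Qed.

Lemma groupe_de_permutations_right_coset n (P : {set 'S_n}) :
  groupe_de_permutations P ->
  exists (H : {group 'S_n}) (a : 'S_n), P = right_coset H a.
Proof.
move=> gP; have [/set0Pn[p pP] _] := gP.
(* Any [p] in [P] serves as representative, because [P = p *: (p^-1 *: P)]. *)
exists (Group (substitutions_from_group_set _ _ _ gP pP)), p.
by rewrite right_cosetE /= substitutions_fromE lcosetKV.
Qed.

Theorem lemma1 (n : nat) (P : {set 'S_n}) (P_nonempty : P != set0) :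
  ((groupe_de_permutations P <->
      exists (H : {group 'S_n}) (a : 'S_n), P = right_coset H a) /\
   (groupe_de_permutations P <->
      exists (H : {group 'S_n}) (a : 'S_n), P = left_coset a H)) /\
  (forall (H : {group 'S_n}) (a : 'S_n),
      P = right_coset H a -> corresponding_groupe_de_substitutions P H) /\
  (forall (H : {group 'S_n}) (a : 'S_n),
      P = left_coset a H ->
      corresponding_groupe_de_substitutions P (conjugate_set a H)).
Proof.
split; [split; split|split].
- exact: groupe_de_permutations_right_coset.
- by move=> [H [a ->]]; case: (right_coset_corresponding _ H a).
- move=> /groupe_de_permutations_right_coset[H [a ->]].
  by exists (H :^ a^-1)%G, a; exact: right_coset_left_coset.
- move=> [H [a ->]]; rewrite left_coset_right_coset.
  by case: (right_coset_corresponding _ (H :^ a)%G a).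
- by move=> H a ->; exact: right_coset_corresponding.
- move=> H a ->; rewrite left_coset_right_coset conjugate_setE.
  exact: right_coset_corresponding.
Qed.
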